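(* Let $u$ and $v$ be vertices belonging to distinct partite sets of a bipartite tournament $D$. Then $u$ and $v$ $(1,2)$-compete in $D$ if and only if $u$ has an out-neighbor different from $v$ and $v$ has an out-neighbor different from $u$.
   Context: A bipartite tournament is an orientation of a complete bipartite graph $K_{m,n}$ ($m,n\ge1$); its partite sets are those of $K_{m,n}$. Vertices $u,v$ of a digraph $D$ $(1,2)$-compete if there is a vertex $w\neq u,v$ such that either there is an arc $(u,w)$ and a directed $(v,w)$-walk of length $2$ not traversing $u$, or there is a directed $(u,w)$-walk of length $2$ not traversing $v$ and an arc $(v,w)$. *)

(* Defs.v *)
From mathcomp Require Import all_boot.

Set Implicit Arguments.
Unset Strict Implicit.
Unset Printing Implicit Defensive.

(* A digraph is encoded by its arc relation D : rel V on a finite vertex type;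
   a simple graph G is encoded likewise, by its adjacency relation. *)

Section Digraphs.

Variable V : finType.
Implicit Types (X Y : {set V}) (G D : rel V) (u v w : V) (p : seq V).

(* X and Y are the partite sets of G, which is then K_{m,n} for m = #|X| and
   n = #|Y|. *)
Definition complete_bipartite X Y G : Prop :=
  [/\ X != set0, Y != set0, [disjoint X & Y], X :|: Y = [set: V] &
      forall x y, G x y = (x \in X) && (y \in Y) || (x \in Y) && (y \in X)].

Definition orientation G D : Prop :=
  (forall x y, G x y = D x y || D y x) /\ (forall x y, ~~ (D x y && D y x)).

Definition bipartite_tournament X Y D : Prop :=
  exists2 G : rel V, complete_bipartite X Y G & orientation G D.

(* The vertices of the walk are v :: p, so its length (number of arcs) is
   size p. *)
Definition directed_walk D v w p : Prop := path D v p /\ last v p = w.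

(* The first vertex argument u is the avoided one; the walk goes from v to w. *)
Definition walk2_avoiding D u v w : Prop :=
  exists p, [/\ directed_walk D v w p, size p = 2 & u \notin v :: p].

Definition compete12 D u v : Prop :=
  exists w, [/\ w != u, w != v &
    (D u w /\ walk2_avoiding D u v w) \/ (walk2_avoiding D v u w /\ D v w)].

End Digraphs.

(* Main.v *)
Require Import Defs.
From mathcomp Require Import all_boot.

(* If u -> x and v -> y with x != v and y != u, then x and y lie in distinct
   partite sets, so they are joined by an arc: its head, y or x, is a common
   (1,2)-step prey, reached through the walk u -> x -> y or v -> y -> x. *)

(** [Y] is the complement of [X], so membership in [X] alone encodes the side of a vertex. Adjacency
    becomes a parity condition, and later questions about sides reduce to Boolean cases. *)
Lemma bipartite_tournament_adjE (V : finType) (X Y : {set V}) (D : rel V)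
    (x y : V) :
  bipartite_tournament X Y D -> D x y || D y x = (x \in X) (+) (y \in X).
Proof.
case=> G [_ _ XY0 XYT GE] [<- _]; rewrite GE.
have YE z : (z \in Y) = (z \notin X).
  have /setUP[zX | zY] : z \in X :|: Y by rewrite XYT inE.
    by rewrite zX (disjointFr XY0 zX).
  by rewrite zY (disjointFl XY0 zY).
by rewrite !YE; case: (x \in X); case: (y \in X).
Qed.

Lemma walk2_avoidingP (V : finType) (D : rel V) (u v w : V) :
  walk2_avoiding D u v w <->
  exists a, [/\ D v a, D a w & [/\ u != v, u != a & u != w]].
Proof.
split=> [[[|a [|b [|c p]]] [[]]] //= | [a [va aw [uv ua uw]]]].
  move=> /and3P[va ab _] <- _; rewrite !inE !negb_or => /and3P[uv ua ub].
  by exists a.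
exists [:: a; w]; split=> //; first by split; rewrite //= va aw.
by rewrite !inE !negb_or uv ua uw.
Qed.

Theorem theorem2p4 (V : finType) (X Y : {set V}) (D : rel V) (u v : V)
  (hD : bipartite_tournament X Y D)
  (huv : (u \in X /\ v \in Y) \/ (u \in Y /\ v \in X)) :
  compete12 D u v <->
  (exists2 x : V, D u x & x != v) /\ (exists2 y : V, D v y & y != u).
Proof.
split=> [[w [wu wv]] | [[x ux xv] [y vy yu]]].
  (* The endpoint with the direct arc takes [w] as its out-neighbor; the other takes the middle
     vertex [a] of its walk, which differs from the avoided endpoint. *)
  case=> [[uw /walk2_avoidingP[a [va _ [_ ua _]]]]
         |[/walk2_avoidingP[a [ua _ [_ va _]]] vw]].
    by split; [exists w | exists a; rewrite // eq_sym].
  by split; [exists a; rewrite // eq_sym | exists w].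
have adjE a b := bipartite_tournament_adjE V X Y D a b hD.
have sides_neq a b : (a \in X) (+) (b \in X) -> a != b.
  by apply: contraTneq => ->; rewrite addbb.
have uvX : (u \in X) (+) (v \in X).
  have [G [_ _ XY0 _ _] _] := hD.
  case: huv => [[uX vY]|[uY vX]]; first by rewrite uX (disjointFl XY0 vY).
  by rewrite vX (disjointFl XY0 uY).
have uxX : (u \in X) (+) (x \in X) by rewrite -adjE ux.
have vyX : (v \in X) (+) (y \in X) by rewrite -adjE vy.
(* Parity: the path [x], [u], [v], [y] changes side three times. *)
have xyX : (x \in X) (+) (y \in X).
  by move: uvX uxX vyX; do 4!case: (_ \in X).
have uv := sides_neq _ _ uvX.
have neq_ux := sides_neq _ _ uxX; have neq_vy := sides_neq _ _ vyX.
(* If [D x y], then [xv] keeps the walk through [x] off [v], and [yu] makes [y] an admissible prey;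
   the roles swap if [D y x]. The other inequalities hold because the vertices lie on opposite
   sides. *)
move: xyX; rewrite -adjE => /orP[xy | yx].
  exists y; split=> //; first by rewrite eq_sym.
  right; split=> //; apply/walk2_avoidingP; exists x; split=> //.
  by split; rewrite // eq_sym.
exists x; split=> //; first by rewrite eq_sym.
left; split=> //; apply/walk2_avoidingP; exists y; split=> //.
by split; rewrite // eq_sym.
Qed.
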